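(* The following bounds hold: $$\dim_H(\mathcal{E}^{(2)}(\mathbb{Z}_3))\ge\log_3\left(\frac{1+\sqrt5}{2}\right)\approx0.438018,$$ $$\dim_H(\mathcal{E}^{(3)}(\mathbb{Z}_3))\ge\log_3\beta_1\approx0.228392,$$ where $\beta_1\approx1.28520$ is a (real) root of $\lambda^6-\lambda^5-1=0$.
   Context: $\mathbb{Z}_3$ denotes the $3$-adic integers with the $3$-adic metric ($|3|_3=1/3$), and $\dim_H$ is Hausdorff dimension with respect to it. For $k\ge1$, $\mathcal{E}^{(k)}(\mathbb{Z}_3)$ is the set of $\lambda\in\mathbb{Z}_3$ such that for at least $k$ values of $n\ge0$ the $3$-adic expansion of $2^n\lambda$ omits the digit $2$ (i.e. $2^n\lambda=\sum_{j\ge0}a_j3^j$ with all $a_j\in\{0,1\}$). *)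

(* Defs.v *)
From HB Require Import structures.
From mathcomp Require Import all_boot all_order all_algebra.
From mathcomp Require Import all_classical all_reals all_analysis.

Set Implicit Arguments.
Unset Strict Implicit.
Unset Printing Implicit Defensive.

Import Order.TTheory GRing.Theory Num.Theory.

Local Open Scope classical_set_scope.
Local Open Scope card_scope.
Local Open Scope ring_scope.

(* The ring of 3-adic integers, as the inverse limit of the rings Z/3^k:
   [res x k] is the residue of [x] modulo 3^k, represented in [0, 3^k[ (the
   coherence condition forces [res x k < 3 ^ k]). *)
Record Z3 := MkZ3 {
  res : nat -> nat ;
  res_coherent : forall k, (res k.+1 %% 3 ^ k)%N = res k }.

HB.instance Definition _ := gen_eqMixin Z3.
HB.instance Definition _ := gen_choiceMixin Z3.

Lemma Z3_eq (x y : Z3) : res x =1 res y -> x = y.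
Proof.
case: x y => [x xc] [y yc] /= /funext xy; subst y.
by congr MkZ3; exact: Prop_irrelevance.
Qed.

Lemma res_mod (x : Z3) (j k : nat) : (j <= k)%N -> (res x k %% 3 ^ j)%N = res x j.
Proof.
move=> /subnKC <-; elim: (k - j)%N => [|n IH].
  by rewrite addn0 -(res_coherent x j) modn_mod.
by rewrite -{}IH -(res_coherent x (j + n)) addnS modn_dvdm// dvdn_exp2l// leq_addr.
Qed.

Lemma res_modn (x : Z3) k : (res x k %% 3 ^ k)%N = res x k.
Proof. exact: res_mod. Qed.

Lemma res_lt (x : Z3) k : (res x k < 3 ^ k)%N.
Proof. by rewrite -res_modn ltn_mod expn_gt0. Qed.

Lemma res_0n (x : Z3) : res x 0 = 0%N.
Proof. by apply/eqP; have := res_lt x 0; rewrite ltnS leqn0. Qed.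

Fact modn_coherent (f : nat -> nat) :
    (forall k, f k.+1 = f k %[mod 3 ^ k]) ->
  forall k, ((f k.+1 %% 3 ^ k.+1) %% 3 ^ k = f k %% 3 ^ k)%N.
Proof. by move=> fP k; rewrite modn_dvdm ?fP// dvdn_exp2l. Qed.

Definition Z3_of (f : nat -> nat) (fP : forall k, f k.+1 = f k %[mod 3 ^ k]) :=
  MkZ3 (modn_coherent fP).

Fact Z3_natP n k : n = n %[mod 3 ^ k]. Proof. by []. Qed.

Fact Z3_addP (x y : Z3) k :
  res x k.+1 + res y k.+1 = res x k + res y k %[mod 3 ^ k].
Proof. by rewrite -modnDm !res_coherent. Qed.

Fact Z3_mulP (x y : Z3) k :
  res x k.+1 * res y k.+1 = res x k * res y k %[mod 3 ^ k].
Proof. by rewrite -modnMm !res_coherent. Qed.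

Fact Z3_oppP (x : Z3) k :
  3 ^ k.+1 - res x k.+1 = 3 ^ k - res x k %[mod 3 ^ k].
Proof.
apply/eqP; rewrite -(eqn_modDr (res x k)) (subnK (ltnW (res_lt _ _))) modnn.
rewrite -(res_coherent x k) modnDmr subnK ?(ltnW (res_lt _ _))//.
by rewrite expnS modnMl.
Qed.

Definition Z3_nat n := Z3_of (Z3_natP n).
Definition Z3_add x y := Z3_of (Z3_addP x y).
Definition Z3_mul x y := Z3_of (Z3_mulP x y).
Definition Z3_opp x := Z3_of (Z3_oppP x).

Fact Z3_addA : associative Z3_add.
Proof. by move=> x y z; apply: Z3_eq => k /=; rewrite modnDml modnDmr addnA. Qed.

Fact Z3_addC : commutative Z3_add.
Proof. by move=> x y; apply: Z3_eq => k /=; rewrite addnC. Qed.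

Fact Z3_add0 : left_id (Z3_nat 0) Z3_add.
Proof. by move=> x; apply: Z3_eq => k /=; rewrite mod0n add0n res_modn. Qed.

Fact Z3_addN : left_inverse (Z3_nat 0) Z3_opp Z3_add.
Proof.
move=> x; apply: Z3_eq => k /=.
by rewrite modnDml subnK ?(ltnW (res_lt _ _))// modnn mod0n.
Qed.

HB.instance Definition _ :=
  GRing.isZmodule.Build Z3 Z3_addA Z3_addC Z3_add0 Z3_addN.

Fact Z3_mulA : associative Z3_mul.
Proof. by move=> x y z; apply: Z3_eq => k /=; rewrite modnMml modnMmr mulnA. Qed.

Fact Z3_mulC : commutative Z3_mul.
Proof. by move=> x y; apply: Z3_eq => k /=; rewrite mulnC. Qed.

Fact Z3_mul1 : left_id (Z3_nat 1) Z3_mul.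
Proof. by move=> x; apply: Z3_eq => k /=; rewrite modnMml mul1n res_modn. Qed.

Fact Z3_mulDl : left_distributive Z3_mul Z3_add.
Proof.
by move=> x y z; apply: Z3_eq => k /=; rewrite modnMml modnDml modnDmr mulnDl.
Qed.

Fact Z3_1neq0 : Z3_nat 1 != 0.
Proof. by apply/eqP => /(congr1 (res^~ 1%N)). Qed.

HB.instance Definition _ := GRing.Zmodule_isComNzRing.Build Z3
  Z3_mulA Z3_mulC Z3_mul1 Z3_mulDl Z3_1neq0.

Lemma res0 k : res 0 k = 0%N. Proof. exact: mod0n. Qed.

Lemma resD (x y : Z3) k : res (x + y) k = ((res x k + res y k) %% 3 ^ k)%N.
Proof. by []. Qed.

Lemma resM (x y : Z3) k : res (x * y) k = ((res x k * res y k) %% 3 ^ k)%N.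
Proof. by []. Qed.

Lemma resN (x : Z3) k : res (- x) k = ((3 ^ k - res x k) %% 3 ^ k)%N.
Proof. by []. Qed.

Lemma res_nat n k : res n%:R k = (n %% 3 ^ k)%N.
Proof.
elim: n => [|n IH]; first by rewrite res0 mod0n.
rewrite -[n.+1%:R]natr1 resD IH (_ : res (1 : Z3) k = (1 %% 3 ^ k)%N)//.
by rewrite modnDml modnDmr addn1.
Qed.

(* The 3-adic absolute value: |x| = 3^-v, where v is the largest exponent such
   that x = 0 modulo 3^v, and |0| = 0. *)
Definition Z3norm (R : realType) (x : Z3) : R :=
  if pselect (exists k, res x k.+1 != 0%N) is left h then 3 ^- ex_minn h else 0.

Section norm_lemmas.
Context {R : realType}.
Implicit Types x y z : Z3.

Lemma Z3norm_ge0 x : 0 <= Z3norm R x.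
Proof. by rewrite /Z3norm; case: pselect => // h; rewrite invr_ge0 exprn_ge0. Qed.

Lemma Z3norm0_eq0 x : Z3norm R x = 0 -> x = 0.
Proof.
rewrite /Z3norm; case: pselect => [h /eqP|h _].
  by rewrite invr_eq0 expf_eq0/= pnatr_eq0 andbF.
apply: Z3_eq => -[|k]; rewrite res0 ?res_0n//.
by apply/eqP/negPn/negP => xk; apply: h; exists k.
Qed.

Lemma Z3norm_le x k : (Z3norm R x <= 3 ^- k) = (res x k == 0%N).
Proof.
rewrite /Z3norm; case: pselect => [h|h]; last first.
  rewrite invr_ge0 exprn_ge0//; apply/esym/negPn/negP => xk; apply: h.
  case: k xk => [|k xk]; last by exists k.
  by rewrite res_0n.
case: ex_minnP => v xv vmin; rewrite lef_pV2 ?posrE ?exprn_gt0//.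
rewrite ler_eXn2l ?ltr1n//; apply/idP/idP => [|xk].
  case: k => [_|k kv]; first by rewrite res_0n.
  by apply/negPn/negP => /vmin; rewrite leqNgt kv.
rewrite leqNgt; apply/negP => vk; move/negP: xv; apply.
by rewrite -(res_mod _ vk) (eqP xk) mod0n.
Qed.

Lemma Z3norm_cases x : x = 0 \/ exists k, Z3norm R x = 3 ^- k.
Proof.
have := @Z3norm0_eq0 x; rewrite /Z3norm; case: pselect => [h _|_ ->//].
  by right; eexists.
by left.
Qed.

Lemma Z3norm0 : Z3norm R 0 = 0.
Proof.
rewrite /Z3norm; case: pselect => // h.
by exfalso; case: h => k; rewrite res0.
Qed.

Lemma Z3normN x : Z3norm R (- x) = Z3norm R x.
Proof.
suff le x' : Z3norm R (- x') <= Z3norm R x'.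
  by apply/eqP; rewrite eq_le le -{1}[x]opprK le.
have [->|[k xk]] := Z3norm_cases x'; first by rewrite oppr0.
have x'k : res x' k == 0%N by rewrite -Z3norm_le xk.
by rewrite xk Z3norm_le resN (eqP x'k) subn0 modnn.
Qed.

Lemma Z3norm_ultra x y :
  Z3norm R (x + y) <= Num.max (Z3norm R x) (Z3norm R y).
Proof.
wlog yx : x y / Z3norm R y <= Z3norm R x => [wlg|].
  have /orP[/wlg//|/wlg] := le_total (Z3norm R y) (Z3norm R x).
  by rewrite addrC maxC.
rewrite (max_idPl yx); have [x0|[k xk]] := Z3norm_cases x.
  by rewrite x0 add0r -x0.
have xk0 : res x k == 0%N by rewrite -Z3norm_le xk.
by move: yx; rewrite xk !Z3norm_le resD (eqP xk0) => /eqP->; rewrite mod0n.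
Qed.

Lemma Z3norm_lt_exp (e : R) : 0 < e -> exists k, 3 ^- k < e :> R.
Proof.
move=> e0; exists (Num.truncn e^-1).+1.
rewrite -[ltRHS]invrK ltf_pV2 ?posrE ?invr_gt0 ?exprn_gt0//.
apply: (lt_le_trans (truncnS_gt _)); rewrite -natrX ler_nat.
by rewrite ltnW// ltn_expl.
Qed.

End norm_lemmas.

(* The 3-adic uniformity is independent of the field of real numbers [R] in
   which distances are measured. *)
Section uniform_structure.
Local Open Scope relation_scope.

Let cong (k : nat) : set (Z3 * Z3) := [set xy | res xy.1 k = res xy.2 k].

Definition Z3_entourage : set_system (Z3 * Z3) := filter_from setT cong.

Fact Z3_entourage_filter : Filter Z3_entourage.
Proof.
apply: filter_from_filter; first by exists 0%N.
move=> i j _ _; exists (maxn i j) => // -[x y]; rewrite /cong/= => xy; split.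
  by rewrite /= -(res_mod x (leq_maxl i j)) xy res_mod ?leq_maxl.
by rewrite /= -(res_mod x (leq_maxr i j)) xy res_mod ?leq_maxr.
Qed.

Fact Z3_entourage_diagonal A : Z3_entourage A -> diagonal `<=` A.
Proof. by move=> [k _ kA] -[x y] xy; apply: kA; rewrite /cong (xy : x = y). Qed.

Fact Z3_entourage_inv A : Z3_entourage A -> Z3_entourage A^-1.
Proof. by move=> [k _ kA]; exists k => // -[x y] /= xy; exact: kA. Qed.

Fact Z3_entourage_split A :
  Z3_entourage A -> exists2 B, Z3_entourage B & B \; B `<=` A.
Proof.
move=> [k _ kA]; exists (cong k); first by exists k.
by move=> -[x z] [y xy yz]; apply: kA; exact: (etrans xy yz).
Qed.

HB.instance Definition _ := isUniform.Build Z3 Z3_entourage_filter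
  Z3_entourage_diagonal Z3_entourage_inv Z3_entourage_split.

End uniform_structure.

Section metric_structure.
Context {R : realType}.

Definition Z3dist (x y : Z3) : R := Z3norm R (x - y).

Lemma Z3dist_le (x y : Z3) k : (Z3dist x y <= 3 ^- k) = (res x k == res y k).
Proof.
rewrite Z3norm_le; apply/eqP/eqP => [xy|xy].
  by rewrite -[in LHS](subrK y x) resD xy add0n res_modn.
rewrite resD resN modnDmr xy addnBA ?(ltnW (res_lt _ _))// addnC addnK.
exact: modnn.
Qed.

Let Z3ball (x : Z3) (e : R) : set Z3 := [set y | Z3dist x y < e].

Fact Z3ball_center (x : Z3) e : 0 < e -> Z3ball x e x.
Proof. by rewrite /Z3ball/= /Z3dist subrr Z3norm0. Qed.

Fact Z3ball_sym (x y : Z3) e : Z3ball x e y -> Z3ball y e x.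
Proof. by rewrite /Z3ball/= /Z3dist -Z3normN opprB. Qed.

Fact Z3ball_triangle (x y z : Z3) e1 e2 :
  Z3ball x e1 y -> Z3ball y e2 z -> Z3ball x (e1 + e2) z.
Proof.
rewrite /Z3ball/= /Z3dist => xy yz; rewrite -[x](subrK y) -addrA.
rewrite (le_lt_trans (Z3norm_ultra _ _))// gt_max.
by rewrite !(le_lt_trans _ (ltrD xy yz))// ?lerDl ?lerDr Z3norm_ge0.
Qed.

Fact Z3_entourageE : entourage = entourage_ Z3ball.
Proof.
apply/seteqP; split=> A [].
  move=> k _ kA; exists (3 ^- k); first by rewrite /= invr_gt0 exprn_gt0.
  by move=> [x y] /ltW /=; rewrite Z3dist_le => /eqP xy; exact: kA.
move=> e /Z3norm_lt_exp[k ke] eA; exists k => // -[x y] /= /eqP xy.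
by apply: eA; rewrite /Z3ball/= (le_lt_trans _ ke)// Z3dist_le.
Qed.

HB.instance Definition _ := Uniform_isPseudoMetric.Build R Z3
  Z3ball_center Z3ball_sym Z3ball_triangle Z3_entourageE.

Fact Z3dist_ge0 x y : 0 <= Z3dist x y. Proof. exact: Z3norm_ge0. Qed.

Fact Z3dist_eq0 x y : Z3dist x y = 0 -> x = y.
Proof. by move/Z3norm0_eq0/subr0_eq. Qed.

Fact Z3_ballE (x : Z3) (e : R) : ball x e = [set y | Z3dist x y < e].
Proof. by []. Qed.

HB.instance Definition _ := PseudoMetric_isMetric.Build R Z3
  Z3dist_ge0 Z3dist_eq0 Z3_ballE.

End metric_structure.

Section hausdorff_dimension.
Context {R : realType} {T : metricType R}.
Local Open Scope ereal_scope.

(* [diam set0 = -oo] *)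
Definition diam (U : set T) : \bar R :=
  ereal_sup [set (mdist x y)%:E | x in U & y in U].

(* diam(U)^s, with the convention that the empty set has weight 0 for all s,
   whereas a point has weight 0^0 = 1 for s = 0. *)
Definition diam_pow (s : R) (U : set T) : \bar R :=
  if U == set0 then 0 else poweR (diam U) s.

Definition hausdorff_premeasure (s delta : R) (E : set T) : \bar R :=
  ereal_inf [set \sum_(0 <= i <oo) diam_pow s (U i) | U in
    [set U : nat -> set T |
      E `<=` \bigcup_i U i /\ forall i, diam (U i) <= delta%:E]].

Definition hausdorff_measure (s : R) (E : set T) : \bar R :=
  ereal_sup [set hausdorff_premeasure s delta E |
    delta in [set delta : R | (0 < delta)%R]].

Definition hausdorff_dim (E : set T) : \bar R :=
  ereal_inf [set s%:E | s in
    [set s : R | (0 <= s)%R /\ hausdorff_measure s E = 0]].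

End hausdorff_dimension.

Definition omits_digit2 (x : Z3) : Prop :=
  exists a : nat -> nat, (forall j, a j = 0%N \/ a j = 1%N) /\
    series (fun j => (a j)%:R * 3%:R ^+ j) @ \oo --> x.

(* [`I_k #<= A] says that A has at least k elements. *)
Definition exceptional_set (k : nat) : set Z3 :=
  [set lambda | `I_k #<= [set n : nat | omits_digit2 (2%:R ^+ n * lambda)]].

Definition log3 {R : realType} (x : R) : R := ln x / ln 3.

(* Main.v *)
From Stdlib Require Import NArith.
Require Import Defs.
From mathcomp Require Import all_boot all_order all_algebra.
From mathcomp Require Import all_classical all_reals all_analysis.
From mathcomp Require Import ring lra zify.

(* In base 3, 4 = 11 and 256 = 100111. If the digits of [x] are 0 or 1 and its
   ones are more than [m] places apart, then for [m = 1] the digits of [4 x] are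
   obtained without carry and are again 0 or 1, and for [m = 5] the same holds
   for [256 x], because the positions 0, 1, 2, 5 differ by at most 5.
   Such strings are concatenations of the blocks [0] and [1 0^m]; giving each
   block of length [l] the weight [beta^-l] defines a probability when
   [beta^(m+1) = beta^m + 1], and cylinders of depth [k] have mass at most
   [beta^-k = (3^-k)^(log3 beta)]. The mass distribution principle then bounds
   the dimension from below by [log3 beta]. *)

Import Order.TTheory GRing.Theory Num.Theory.
Local Open Scope ring_scope.

(** * Digit expansions modulo powers of 3 *)

(** Coefficients may exceed 2: expansions then add coefficientwise, and the absence of carries is
    checked only on the final coefficients. *)
Definition expands (x : Z3) (a : nat -> nat) : Prop :=
  forall k, res x k = ((\sum_(j < k) a j * 3 ^ j) %% 3 ^ k)%N.

Lemma expands_prefix {x a} k n : expands x a -> (k <= n)%N ->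
  ((\sum_(j < n) a j * 3 ^ j) %% 3 ^ k)%N = res x k.
Proof.
by move=> xa kn; rewrite -(res_mod x kn) xa modn_dvdm// dvdn_exp2l.
Qed.

Lemma expands_cvg (x : Z3) (a : nat -> nat) : expands x a ->
  (series (fun j => (a j)%:R * 3%:R ^+ j) @ \oo --> x)%classic.
Proof.
move=> xa; apply/cvg_entourageP => A [k _ kA].
exists k => // n /= kn; apply: kA => /=.
rewrite /series /= big_mkord -(expands_prefix k n xa kn) -res_nat natr_sum.
by congr res; apply: eq_bigr => j _; rewrite natrM natrX.
Qed.

Lemma expandsD {x y a b} : expands x a -> expands y b ->
  expands (x + y) (fun j => (a j + b j)%N).
Proof.
move=> xa yb k; rewrite resD xa yb modnDml modnDmr -big_split /=.
by congr (_ %% _)%N; apply: eq_bigr => j _; rewrite mulnDl.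
Qed.

Lemma expands_mul3 {x a} : expands x a ->
  expands (3%:R * x) (fun j => if j is j'.+1 then a j' else 0%N).
Proof.
move=> xa [|k]; first by rewrite !res_0n big_ord0.
rewrite big_ord_recl mul0n add0n resM res_nat modnMml.
rewrite -modnMmr (xa k.+1) modnMmr modnMmr big_ord_recr /= mulnDr.
rewrite (mulnCA 3) -expnS -modnDmr modnMl addn0 big_distrr /=.
by congr (_ %% _)%N; apply: eq_bigr => j _; rewrite mulnCA -expnS.
Qed.

Lemma expands_omits (x : Z3) (a : nat -> nat) :
  expands x a -> (forall j, (a j <= 1)%N) -> omits_digit2 x.
Proof.
move=> xa a1; exists a; split; last exact: expands_cvg.
by move=> j; move: (a1 j); case: (a j) => [|[|]]//; [left|right].
Qed.

(** * Gapped strings and their products with 4 and 256 *)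

Definition gapped (m : nat) (a : nat -> bool) : Prop :=
  forall i d, (0 < d <= m)%N -> a i -> a (d + i)%N = false.

Definition gapped_set (m : nat) : set Z3 :=
  [set x | exists2 a : nat -> bool, gapped m a & expands x (fun j => a j)].

Lemma exceptional_setP (s : seq nat) (x : Z3) : uniq s ->
  (forall n, n \in s -> omits_digit2 (2%:R ^+ n * x)) ->
  exceptional_set (size s) x.
Proof.
move=> us sx; rewrite /exceptional_set /=.
(* The cardinal inequality is witnessed by a surjection onto the positions in [s]. *)
apply/pcard_surjP; exists (index^~ s) => i /= si.
exists (nth 0%N s i); [exact/sx/mem_nth | exact: index_uniq].
Qed.

Lemma gapped_set_omits4 {x : Z3} {m} : gapped_set m x ->
  (0 < m)%N -> omits_digit2 (4%:R * x).
Proof.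
move=> [a ga xa] m0.
have -> : 4%:R * x = x + 3%:R * x by rewrite -[4%N]/(1 + 3)%N natrD mulrDl mul1r.
apply: (expands_omits _ _ (expandsD xa (expands_mul3 xa))) => -[|j].
  by rewrite addn0 leq_b1.
by have := ga j 1%N m0; case: (a j) => [->|] //; rewrite addn0 leq_b1.
Qed.

Lemma gapped_set_omits256 {x : Z3} {m} : gapped_set m x ->
  (4 < m)%N -> omits_digit2 (256%:R * x).
Proof.
move=> [a ga xa] m4.
have x3 := expands_mul3 xa; have x9 := expands_mul3 x3.
have x243 := expands_mul3 (expands_mul3 (expands_mul3 x9)).
have -> : 256%:R * x = x + 3%:R * x + 3%:R * (3%:R * x) +
    3%:R * (3%:R * (3%:R * (3%:R * (3%:R * x)))).
  by ring.
apply: (expands_omits _ _ (expandsD (expandsD (expandsD xa x3) x9) x243)) => j.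
(* A coefficient of [256 x] sums at most four digits of [x], pairwise at most 5 places apart. No two
   of them are both 1, so the pairwise bounds force the whole sum to be at most 1. *)
have g d i : (0 < d <= 5)%N -> (a i + a (iter d succn i) <= 1)%N.
  move=> /andP[d0 d5]; have := ga i d.
  rewrite d0 (leq_trans d5 m4) iter_succn [(d + i)%N]addnC => /(_ isT).
  by case: (a i) => [->|_] //; exact: leq_b1.
case: j => [|[|[|[|[|j]]]]] /=; rewrite ?addn0 ?add0n ?leq_b1//.
- by have /= := g 1%N 0%N isT; lia.
- by have /= := g 1%N 0%N isT; have /= := g 1%N 1%N isT; have /= := g 2%N 0%N isT; lia.
- by have /= := g 1%N 1%N isT; have /= := g 1%N 2%N isT; have /= := g 2%N 1%N isT; lia.
- by have /= := g 1%N 2%N isT; have /= := g 1%N 3%N isT; have /= := g 2%N 2%N isT; lia.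
- have /= := g 1%N j.+4 isT; have /= := g 1%N j.+3 isT; have /= := g 2%N j.+3 isT.
  by have /= := g 3%N j isT; have /= := g 4%N j isT; have /= := g 5%N j isT; lia.
Qed.

Lemma gapped_set_E2 (x : Z3) : gapped_set 1 x -> exceptional_set 2 x.
Proof.
move=> xm; apply: (exceptional_setP [:: 0; 2]%N) => // n.
rewrite !inE => /orP[] /eqP->; rewrite -?natrX;
  last exact: (gapped_set_omits4 xm isT).
case: xm => a _ xa; rewrite mul1r.
by apply: (expands_omits _ _ xa) => j; rewrite leq_b1.
Qed.

Lemma gapped_set_E3 (x : Z3) : gapped_set 5 x -> exceptional_set 3 x.
Proof.
move=> xm; apply: (exceptional_setP [:: 0; 2; 8]%N) => // n.
rewrite !inE => /or3P[] /eqP->; rewrite -?natrX.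
- case: xm => a _ xa; rewrite mul1r.
  by apply: (expands_omits _ _ xa) => j; rewrite leq_b1.
- exact: (gapped_set_omits4 xm isT).
- exact: (gapped_set_omits256 xm isT).
Qed.

(** * Mass of a node inside a cylinder *)

(* A node [(n, v, r)] stands for the admissible digit strings of length [n] and
   value [v] after which [r] zeros are still forced; its mass is [b ^+ (n + r)].
   [cyl_mass b m k c f n v r] is the mass of the part of the node that lies in
   the cylinder [{x | res x k = c}], computed by splitting [f = k - n] times. *)
Fixpoint cyl_mass {R : realType} (b : R) (m k c f n v r : nat) : R :=
  if f is f'.+1 then
    if r is r'.+1 then cyl_mass b m k c f' n.+1 v r'
    else cyl_mass b m k c f' n.+1 v 0 + cyl_mass b m k c f' n.+1 (v + 3 ^ n) m
  else if v == c %[mod 3 ^ k] then b ^+ (n + r) else 0.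

Lemma cyl_mass_ge0 {R : realType} (b : R) m k c f n v r :
  0 <= b -> 0 <= cyl_mass b m k c f n v r.
Proof.
move=> b0; elim: f n v r => [|f IH] n v [|r] //=; last exact: addr_ge0.
- by case: ifP => // _; exact: exprn_ge0.
- by case: ifP => // _; exact: exprn_ge0.
Qed.

(** When [n >= k], [k - n] truncates to 0 and both sides are leaves with the same exponent. *)
Lemma cyl_mass_forced {R : realType} (b : R) m k c n v r :
  cyl_mass b m k c (k - n) n v r.+1 = cyl_mass b m k c (k - n.+1) n.+1 v r.
Proof.
have [kn|nk] := leqP k n; last by rewrite -(subnSK nk).
by have /eqP-> := kn; have /eqP-> := leqW kn; rewrite /= addSnnS.
Qed.

(** When [n >= k], adding [3 ^ n] keeps the residue modulo [3 ^ k], and [b ^+ n] splits by the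
    equation for [b]. *)
Lemma cyl_mass_split {R : realType} (b : R) m k c n v : b + b ^+ m.+1 = 1 ->
  cyl_mass b m k c (k - n) n v 0 =
  cyl_mass b m k c (k - n.+1) n.+1 v 0 +
  cyl_mass b m k c (k - n.+1) n.+1 (v + 3 ^ n) m.
Proof.
move=> b1; have [kn|nk] := leqP k n; last by rewrite -(subnSK nk).
have /eqP-> := kn; have /eqP-> := leqW kn => /=.
have /eqP vn : (v + 3 ^ n = v %[mod 3 ^ k])%N.
  by rewrite -modnDmr (eqP (dvdn_exp2l 3 kn)) addn0.
rewrite -(modn_mod (v + _)) (eqP vn) modn_mod; case: ifP => _; last by rewrite addr0.
by rewrite !addn0 addSnnS exprD exprSr -mulrDr b1 mulr1.
Qed.

(** Later digits add multiples of [3 ^ n], so a wrong residue is never repaired. *)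
Lemma cyl_mass_eq0 {R : realType} (b : R) m k c f n v r : (n + f = k)%N ->
  v != c %[mod 3 ^ n] -> cyl_mass b m k c f n v r = 0.
Proof.
elim: f n v r => [|f IH] n v r.
  by rewrite addn0 => <- /negPf /= ->.
have modS (u w : nat) : (u == w %[mod 3 ^ n.+1]) -> (u == w %[mod 3 ^ n]).
  move=> /eqP uw; apply/eqP.
  by rewrite -(modn_dvdm u (dvdn_exp2l 3 (leqnSn n))) uw modn_dvdm ?dvdn_exp2l.
rewrite addnS -addSn => nfk vc.
case: r => [|r] /=; last by apply: IH => //; apply: contra vc; exact: modS.
rewrite !IH ?addr0//; apply: contra vc; last exact: modS.
by move=> /modS; rewrite modnDr.
Qed.

(** Two children differ in digit [n], so at most one of them meets the cylinder. Only one leaf can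
    contribute, and it weighs [b ^+ (k + r)]. *)
Lemma cyl_mass_le {R : realType} (b : R) m k c f n v r : 0 <= b <= 1 ->
  (n + f = k)%N -> (v < 3 ^ n)%N -> cyl_mass b m k c f n v r <= b ^+ k.
Proof.
move=> /andP[b0 b1]; elim: f n v r => [|f IH] n v r.
  rewrite addn0 => <- _ /=; case: ifP => _; last exact: exprn_ge0.
  by rewrite exprD ler_piMr ?exprn_ge0 ?exprn_ile1.
rewrite addnS -addSn => nfk vn.
have v3 : (v + 3 ^ n < 3 ^ n.+1)%N.
  by rewrite expnS; lia.
have v3' : (v < 3 ^ n.+1)%N by rewrite (leq_ltn_trans _ v3) ?leq_addr.
case: r => [|r] /=; last exact: IH.
have [/eqP vc|vc] := boolP (v == c %[mod 3 ^ n.+1]); last first.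
  by rewrite cyl_mass_eq0// add0r IH.
rewrite [X in _ + X]cyl_mass_eq0 ?addr0 ?IH//.
rewrite -vc !modn_small//; apply/eqP => /eqP.
by rewrite -[X in _ == X]addn0 eqn_add2l expn_eq0.
Qed.

(** * Greedy construction of a point outside given cylinders *)

(* [s = (v, r)] holds the value [v] of the digits chosen so far and the number
   [r] of zeros still forced; [go0 n v] says that the digit 0 is acceptable. *)
Definition take_one (go0 : nat -> nat -> bool) (n : nat) (s : nat * nat) : bool :=
  (s.2 == 0%N) && ~~ go0 n s.1.

Fixpoint greedy (m : nat) (go0 : nat -> nat -> bool) (n : nat) : nat * nat :=
  if n is n'.+1 then
    let s := greedy m go0 n' in
    if take_one go0 n' s then ((s.1 + 3 ^ n')%N, m) else (s.1, s.2.-1)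
  else (0%N, 0%N).

Definition greedy_digit m go0 n := take_one go0 n (greedy m go0 n).

Lemma greedy_sum m go0 n :
  (greedy m go0 n).1 = (\sum_(j < n) greedy_digit m go0 j * 3 ^ j)%N.
Proof.
elim: n => [|n IH]; first by rewrite big_ord0.
rewrite big_ord_recr /= -IH /greedy_digit; case: take_one => //=.
  by rewrite mul1n.
by rewrite mul0n addn0.
Qed.

Lemma greedy_gapped m go0 : gapped m (greedy_digit m go0).
Proof.
move=> i d /andP[d0 dm] ai.
(* The one at [i] sets the counter to [m]; it drops by one per place and so stays positive over the
   next [m] places. *)
suff H : (greedy m go0 (d + i)).2 = (m.+1 - d)%N.
  by rewrite /greedy_digit /take_one H subn_eq0 ltnNge dm.
case: d d0 dm => // d _; elim: d => [|d IH] dm.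
  by rewrite /= (ai : take_one _ _ _ = true) /= subn1.
have {}IH := IH (ltnW dm); rewrite (addSn d.+1) /= ifF; first by rewrite IH /=; lia.
by rewrite /take_one IH subn_eq0 ltnNge ltnW.
Qed.

Lemma greedy_expands m go0 : exists2 x : Z3, gapped_set m x &
  forall k, res x k = ((greedy m go0 k).1 %% 3 ^ k)%N.
Proof.
have coh k : (greedy m go0 k.+1).1 = (greedy m go0 k).1 %[mod 3 ^ k].
  by rewrite !greedy_sum big_ord_recr /= -modnDmr modnMl addn0.
exists (Z3_of coh) => //; exists (greedy_digit m go0); first exact: greedy_gapped.
by move=> k; rewrite /= greedy_sum.
Qed.

(* Follow a path of nodes each of which carries more mass than the cylinders
   meeting it: it never ends up inside a cylinder. *)
Lemma gapped_set_uncovered {R : realType} (b : R) (m : nat) (k c : nat -> nat) :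
  0 <= b <= 1 -> b + b ^+ m.+1 = 1 ->
  (\sum_(i <oo) (b ^+ k i)%:E < 1)%E ->
  exists2 x : Z3, gapped_set m x & forall i, res x (k i) <> c i.
Proof.
move=> b01 b1 kc; have b0 : 0 <= b by case/andP: b01.
pose M n v r i : \bar R := (cyl_mass b m (k i) (c i) (k i - n) n v r)%:E.
pose h n v r : \bar R := (\sum_(i <oo) M n v r i)%E.
have M0 n v r i : (0 <= M n v r i)%E by rewrite lee_fin cyl_mass_ge0.
pose go0 n v := (h n.+1 v 0%N < (b ^+ n.+1)%:E)%E.
have [x xm xE] := greedy_expands m go0.
have inv n : (h n (greedy m go0 n).1 (greedy m go0 n).2 <
              (b ^+ (n + (greedy m go0 n).2))%:E)%E.
  elim: n => [|n]; rewrite ?expr0 /=.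
    apply: le_lt_trans kc; apply: lee_nneseries => // i _.
    by rewrite lee_fin cyl_mass_le// subn0.
  case: (greedy m go0 n) => v r /=; rewrite /take_one /=.
  case: r => [|r] /=; last first.
    rewrite addSnnS; congr (_ < _)%E; apply: eq_eseriesr => i _.
    by rewrite /M cyl_mass_forced.
  rewrite addn0; case: ifPn => /= [ngo|]; last by rewrite negbK addn0.
  have -> : (h n v 0%N = h n.+1 v 0%N + h n.+1 (v + 3 ^ n)%N m)%E.
    rewrite -nneseriesD//; apply: eq_eseriesr => i _.
    by rewrite /M cyl_mass_split// EFinD.
  (* If the child with digit 1 were filled as well, the two children would add up to a filled
     parent. *)
  apply: contraTT; rewrite -!leNgt => hm.
  have -> : b ^+ n = b ^+ n.+1 + b ^+ (n.+1 + m).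
    by rewrite addSnnS exprD exprSr -mulrDr b1 mulr1.
  by rewrite EFinD leeD// leNgt.
exists x => // i xi; have := inv (k i); set v := (X in h _ X); set r := (X in h _ _ X).
apply/negP; rewrite -leNgt.
(* At depth [k i] the node lies inside cylinder [i], so this single term is already its full
   mass. *)
have -> : (b ^+ (k i + r))%:E = M (k i) v r i.
  by rewrite /M subnn /= -/v -(xE (k i)) -xi res_modn eqxx.
rewrite /h (nneseriesD1 (n := i))//; apply: leeDl; exact: nneseries_ge0.
Qed.

(** * From covers by arbitrary sets to cylinders *)

Lemma exprn_lt {R : realType} (b e : R) : 0 <= b < 1 -> 0 < e -> exists k, b ^+ k < e.
Proof.
move=> /andP[b0 b1] e0.
have := @cvg_expr R b; rewrite ger0_norm// => /(_ b1)/cvgrPdist_lt/(_ _ e0)[k _ kP].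
exists k; have := kP k (leqnn k).
by rewrite /= sub0r normrN ger0_norm// exprn_ge0.
Qed.

Lemma powR_log3 {R : realType} (beta : R) (n : nat) : 0 < beta ->
  (3 ^- n) `^ log3 beta = beta ^- n.
Proof.
move=> beta0; have n0 : (3 ^- n : R) \is Num.pos by rewrite posrE invr_gt0 exprn_gt0.
rewrite /powR gt_eqF ?(posrE n0)// lnV ?posrE ?exprn_gt0// lnXn ?posrE//.
rewrite /log3 mulrN mulrnAr divfK; last by rewrite gt_eqF// ln_gt0// ltr1n.
by rewrite -lnXn// expRN lnK// posrE exprn_gt0.
Qed.

Lemma diam_ub {R : realType} {T : metricType R} (U : set T) (x y : T) :
  U x -> U y -> ((mdist x y)%:E <= diam U)%E.
Proof. by move=> Ux Uy; apply: ereal_sup_ubound; exists x => //; exists y. Qed.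

Lemma diam0 {R : realType} {T : metricType R} : diam (set0 : set T) = -oo%E.
Proof.
by rewrite -ereal_sup0; congr ereal_sup; rewrite -subset0 => _ [x []].
Qed.

Lemma diam_pow_ge0 {R : realType} {T : metricType R} (s : R) (U : set T) :
  (0 <= diam_pow s U)%E.
Proof. by rewrite /diam_pow; case: ifP => // _; exact: poweR_ge0. Qed.

Lemma diam_Z3_cylinder {R : realType} (U : set Z3) (k : nat) :
  (diam (R := R) U <= (3 ^- k)%:E)%E -> exists c, forall x, U x -> res x k = c.
Proof.
move=> Uk; have [[x0 Ux0]|U0] := pselect (exists x, U x); last first.
  by exists 0%N => x Ux; exfalso; apply: U0; exists x.
exists (res x0 k) => x Ux; apply/eqP; rewrite -(@Z3dist_le R) -lee_fin.
exact: le_trans (diam_ub _ _ _ Ux Ux0) Uk.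
Qed.

(** For positive diameter, [k] satisfies 3^-(k+1) < diam U <= 3^-k, and the factor [beta] pays for
    this rounding. The error [e] pays for empty sets and points, which lie in cylinders of every
    depth. *)
Lemma diam_pow_cylinder {R : realType} (beta s e : R) (U : set Z3) :
  1 < beta -> s <= log3 beta -> 0 < e -> (diam (R := R) U <= 1)%E ->
  exists k c, (forall x, U x -> res x k = c) /\
    ((beta^-1 ^+ k)%:E <= beta%:E * diam_pow (R := R) s U + e%:E)%E.
Proof.
move=> beta1 sbeta e0 U1; have beta0 : 0 < beta by apply: lt_trans beta1.
have [U0|U0] := leP (diam (R := R) U) 0%E.
  have [|k ke] := @exprn_lt R beta^-1 e _ e0.
    by rewrite invr_ge0 (ltW beta0) invf_lt1.
  have [|c cP] := @diam_Z3_cylinder R U k.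
    by apply: (le_trans U0); rewrite lee_fin invr_ge0 exprn_ge0.
  exists k, c; split=> //; apply: (@le_trans _ _ e%:E); first by rewrite lee_fin ltW.
  by rewrite leeDr// mule_ge0 ?diam_pow_ge0// lee_fin ltW.
have UE : diam (R := R) U = (fine (diam (R := R) U))%:E.
  rewrite fineK// ge0_fin_numE ?(ltW U0)//.
  exact: le_lt_trans U1 (ltry _).
move: U0 U1; rewrite UE !lee_fin lte_fin; set d := fine _ => d0 d1.
have [[|k] kd kmin] := @ex_minnP (fun k => 3 ^- k < d) (Z3norm_lt_exp d0).
  by move: kd; rewrite expr0 invr1 ltNge d1.
have dk : d <= 3 ^- k.
  by rewrite leNgt; apply/negP => /kmin; rewrite ltnn.
have [|c cP] := @diam_Z3_cylinder R U k; first by rewrite UE lee_fin.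
exists k, c; split=> //.
rewrite /diam_pow ifF; last first.
  (* The empty set has diameter -oo, which [fine] sends to 0, against [d0]. *)
  by apply/eqP => U0; move: d0; rewrite /d U0 diam0 /= ltxx.
rewrite UE poweR_EFin -EFinM -EFinD lee_fin -/d.
have -> : beta^-1 ^+ k = beta * (3 ^- k.+1) `^ log3 beta.
  by rewrite powR_log3// exprS invfM mulrA divff ?gt_eqF// mul1r exprVn.
apply: (@le_trans _ _ (beta * d `^ s)); last by rewrite lerDl ltW.
rewrite ler_pM2l//; apply: (@le_trans _ _ (d `^ log3 beta)).
  apply: ge0_ler_powR; rewrite ?nnegrE ?invr_ge0 ?exprn_ge0 ?(ltW kd) ?(ltW d0)//.
  by rewrite divr_ge0 ?ln_ge0 ?ler1n// ltW.
by apply: ger_powR => //; rewrite d0 d1.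
Qed.

(** If the measure vanished for some [s < log3 beta], a cheap cover could be enlarged to cylinders
    of total weight below 1, and these miss a gapped point. *)
Lemma gapped_set_dim {R : realType} (beta : R) (m : nat) (E : set Z3) :
  1 < beta -> beta ^+ m.+1 = beta ^+ m + 1 -> (gapped_set m `<=` E)%classic ->
  ((log3 beta)%:E <= hausdorff_dim (R := R) E)%E.
Proof.
move=> beta1 betam mE; have beta0 : 0 < beta by apply: lt_trans beta1.
apply: le_ereal_inf_tmp => _ [s [s0 Es] <-]; rewrite lee_fin leNgt; apply/negP => sbeta.
(* After multiplication by [beta] this bound becomes 1/2; the errors [e i] below sum to the other
   half. *)
have : (hausdorff_premeasure (R := R) s 1 E < (2^-1 * beta^-1)%:E)%E.
  apply: (@le_lt_trans _ _ 0%E); last by rewrite lte_fin mulr_gt0 ?invr_gt0.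
  by rewrite -Es; apply: ereal_sup_ubound; exists 1 => //=.
move=> /ereal_inf_lt[_ [U [EU U1] <-] Usum].
pose e i : R := 2^-1 / (2 ^ i.+1)%:R.
have e0 i : 0 < e i by rewrite divr_gt0 ?invr_gt0 ?ltr0n ?expn_gt0.
have /choice[k /choice[c kc]] i := @diam_pow_cylinder R beta s (e i) (U i) beta1
  (ltW sbeta) (e0 i) (U1 i).
have [|||x xm xk] := @gapped_set_uncovered R beta^-1 m k c.
- by rewrite invr_ge0 invf_le1// ltW//= ltW.
- rewrite exprVn; apply: (@mulfI _ (beta ^+ m.+1)); first by rewrite expf_neq0// gt_eqF.
  rewrite mulrDr mulr1 divff ?expf_neq0 ?gt_eqF// {1}exprSr mulfK ?gt_eqF//.
- have B0 i : (0 <= beta%:E * diam_pow (R := R) s (U i))%E.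
    by rewrite mule_ge0 ?diam_pow_ge0// lee_fin ltW.
  apply: (@le_lt_trans _ _ (\sum_(i <oo) (beta%:E * diam_pow (R := R) s (U i) + (e i)%:E))%E).
    apply: lee_nneseries => [i _ _|i _]; last by case: (kc i).
    by rewrite lee_fin exprn_ge0// invr_ge0 ltW.
  apply: (le_lt_trans (epsilon_trick _ _ _)) => //.
  rewrite nneseriesZl; last by move=> i _; exact: diam_pow_ge0.
  rewrite -lteBrDr// -EFinB.
  have -> : 1 - 2^-1 = beta * (2^-1 * beta^-1) by field; rewrite gt_eqF.
  by rewrite EFinM lte_pmul2l.
have [i _ Ui] := EU _ (mE _ xm).
by case: (kc i) => /(_ _ Ui) + _; exact: xk.
Qed.

(** * Certified decimals of logarithms *)

(* Binary digits of [log3 x] in fixed-point arithmetic with denominator [D]: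
   squaring doubles the logarithm, and a factor 3 yields a digit 1. In the pair
   [(a, L)] obtained after [n] steps, [x ^ (2 ^ n) >= 3 ^ a * (L / D)]. *)
Definition log3_step (D : N) (s : N * N) : N * N :=
  let L2 := (s.2 * s.2)%num in
  if (3 * D * D <=? L2)%num then ((2 * s.1 + 1)%num, (L2 / (3 * D))%num)
  else ((2 * s.1)%num, (L2 / D)%num).

(** Squaring the bound squares [y], and both integer divisions round down, which preserves a lower
    bound. *)
Lemma log3_step_le {R : realType} (D : N) (s : N * N) (y : R) : (0 < D)%num ->
  3 ^+ N.to_nat s.1 * (N.to_nat s.2)%:R <= y * (N.to_nat D)%:R ->
  let s' := log3_step D s in
  3 ^+ N.to_nat s'.1 * (N.to_nat s'.2)%:R <= y ^+ 2 * (N.to_nat D)%:R.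
Proof.
case: s => a L D0 /= aL.
have D0' : 0 < (N.to_nat D)%:R :> R by rewrite ltr0n; lia.
have aL2 : (3 ^+ N.to_nat a) ^+ 2 * (N.to_nat L * N.to_nat L)%:R
    <= y ^+ 2 * (N.to_nat D)%:R * (N.to_nat D)%:R.
  have L0 : 0 <= 3 ^+ N.to_nat a * (N.to_nat L)%:R :> R by rewrite mulr_ge0 ?exprn_ge0.
  rewrite natrM -!expr2 -mulrA -expr2 -!exprMn lerXn2r ?nnegrE//.
  exact: le_trans aL.
rewrite -(ler_pM2r D0'); apply: le_trans aL2; rewrite /log3_step.
have A0 : 0 < (3 ^+ N.to_nat a : R) ^+ 2 by rewrite !exprn_gt0.
have div k : (0 < k)%num -> (N.to_nat (L * L / k) * N.to_nat k <= N.to_nat L * N.to_nat L)%N.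
  by move=> k0; have := N.Div0.mul_div_le (L * L) k; lia.
case: ifP => _; rewrite [_.1]/= [_.2]/=.
  have -> : N.to_nat (2 * a + 1) = (N.to_nat a * 2).+1 by lia.
  rewrite exprSr exprM; move: ((3 ^+ N.to_nat a) ^+ 2) A0 => A A0.
  rewrite -!mulrA ler_pM2l// -!natrM ler_nat.
  rewrite mulnCA (_ : (3 * N.to_nat D)%N = N.to_nat (3 * D)); last by lia.
  by apply: div; case: (D) D0.
have -> : N.to_nat (2 * a) = (N.to_nat a * 2)%N by lia.
rewrite exprM; move: ((3 ^+ N.to_nat a) ^+ 2) A0 => A A0.
by rewrite -!mulrA ler_pM2l// -!natrM ler_nat; exact: div.
Qed.

(** Once the final [L] is at least [D], [s.1 / 2 ^ n] bounds [log3 x] from below. The last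
    hypothesis is settled by evaluation in binary arithmetic. *)
Lemma log3_gt {R : realType} (x : R) (D : N) (n p q c d : nat) :
  (0 < q)%N -> p%:R <= x * q%:R ->
  (0 < D)%num ->
  (let s := iter n (log3_step D) (0%num, (N.of_nat p * D / N.of_nat q)%num) in
   (D <=? s.2)%num &&
   ((N.of_nat c * 1000 + N.of_nat d) * 2 ^ N.of_nat n <? s.1 * 1000 * 1000)%num) ->
  c%:R / 10 ^+ 3 + d%:R / 10 ^+ 6 < log3 x.
Proof.
move=> q0 px D0 /=.
set s := iter _ _ _ => /andP[Ds cs].
have D0' : 0 < (N.to_nat D)%:R :> R by rewrite ltr0n; lia.
have H : 3 ^+ N.to_nat s.1 * (N.to_nat s.2)%:R <= x ^+ (2 ^ n) * (N.to_nat D)%:R.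
  rewrite /s; elim: (n) => [|i IH]; last first.
    by rewrite iterS expnSr exprM; exact: (log3_step_le _ _ _ D0 IH).
  rewrite /= expr0 mul1r expr1 -(@ler_pM2r _ q%:R) ?ltr0n// mulrAC.
  apply: (@le_trans _ _ (p%:R * (N.to_nat D)%:R)); last by rewrite ler_pM2r.
  rewrite -!natrM ler_nat.
  by have := N.Div0.mul_div_le (N.of_nat p * D) (N.of_nat q); lia.
have x3 : 3 ^+ N.to_nat s.1 <= x ^+ (2 ^ n).
  rewrite -(ler_pM2r D0'); apply: le_trans H.
  by rewrite ler_pM2l ?exprn_gt0// ler_nat; lia.
have x0 : 0 < x.
  have : 0 <= x by rewrite -(@pmulr_lge0 _ q%:R) ?ltr0n// (le_trans _ px).
  rewrite le_eqVlt => /predU1P[x0|//]; exfalso; move: x3.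
  by rewrite -x0 expr0n expn_eq0 /= leNgt exprn_gt0.
have ln3 : 0 < ln 3 :> R by rewrite ln_gt0// ltr1n.
have lnx : (N.to_nat s.1)%:R * ln 3 <= (2 ^ n)%:R * ln x.
  by rewrite !mulr_natl -!lnXn ?posrE// ler_ln ?posrE ?exprn_gt0.
have {}cs : ((c * 1000 + d) * 2 ^ n < N.to_nat s.1 * 1000 * 1000)%N by lia.
have {cs} : (c%:R * 1000%:R + d%:R) * (2 ^ n)%:R < (N.to_nat s.1)%:R * 1000%:R * 1000%:R :> R.
  by rewrite -!(natrM, natrD) ltr_nat.
move: lnx; set A := (N.to_nat _)%:R; set B := (2 ^ n)%:R => lnx AB.
have B0 : 0 < B by rewrite ltr0n expn_gt0.
rewrite /log3 ltr_pdivlMr// -(ltr_pM2l B0); apply: lt_le_trans lnx.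
rewrite mulrA ltr_pM2r//; lra.
Qed.

(** Obtained from the lower bound for 3/x, since [log3 (3 / x) = 1 - log3 x]. *)
Lemma log3_lt {R : realType} (x : R) (D : N) (n p q c d : nat) :
  (0 < p)%N -> 0 < x -> x * q%:R <= p%:R ->
  (0 < D)%num ->
  (let s := iter n (log3_step D) (0%num, (N.of_nat (3 * q) * D / N.of_nat p)%num) in
   (D <=? s.2)%num &&
   ((N.of_nat c * 1000 + N.of_nat d) * 2 ^ N.of_nat n <? s.1 * 1000 * 1000)%num) ->
  log3 x < 1 - (c%:R / 10 ^+ 3 + d%:R / 10 ^+ 6).
Proof.
move=> p0 x0 xp D0 H; rewrite ltrBrDl -ltrBrDr.
have -> : 1 - log3 x = log3 (3 / x).
  rewrite /log3 lnM ?posrE ?invr_gt0// lnV ?posrE// mulrBl divff// gt_eqF// ln_gt0//.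
  by rewrite ltr1n.
apply: (log3_gt _ D _ _ _ _ _ p0 _ D0 H).
by rewrite mulrAC ler_pdivlMr// natrM -mulrA ler_pM2l// mulrC.
Qed.

(** * Rational enclosures of the two roots, and the conclusion *)

(** The bounds 987/610 and 1597/987 are quotients of consecutive Fibonacci numbers. *)
Lemma golden_ratio_bounds {R : realType} (phi : R) : phi = (1 + Num.sqrt 5) / 2 ->
  [/\ phi ^+ 2 = phi ^+ 1 + 1, 987%:R <= phi * 610%:R & phi * 987%:R <= 1597%:R].
Proof.
move=> ->; have := @sqr_sqrtr R 5 (ler0n _ _); have := @sqrtr_ge0 R 5.
rewrite !expr2 expr1; set s := Num.sqrt _ => s0 s5; split; first by lra.
- by nra.
- by nra.
Qed.

(** The polynomial changes sign between 356/277 and 1789/1392, which are close enough for their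
    [log3] to fit in a window of width 2/10^6. *)
Lemma beta1_exists {R : realType} : exists beta : R,
  [/\ beta ^+ 6 = beta ^+ 5 + 1, 356%:R <= beta * 277%:R & beta * 1392%:R <= 1789%:R].
Proof.
have [| |b /andP[lb ub]] := @poly_ivt R ('X^6 - 'X^5 - 1) (356 / 277) (1789 / 1392).
- by lra.
- by rewrite !hornerE; apply/andP; split; lra.
rewrite rootE !hornerE => /eqP bE; exists b; split; [|move: lb|move: ub]; rewrite /=; lra.
Qed.

Theorem theorem5p2 (R : realType) :
  let phi : R := (1 + Num.sqrt 5) / 2 in
  [/\ ((log3 phi)%:E <= hausdorff_dim (R := R) (exceptional_set 2))%E,
      `|log3 phi - (438 / 10 ^+ 3 + 18 / 10 ^+ 6)| < 1 / 10 ^+ 6 &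
      exists beta1 : R,
        [/\ beta1 ^+ 6 - beta1 ^+ 5 - 1 = 0,
            `|beta1 - (1 + 285 / 10 ^+ 3 + 20 / 10 ^+ 5)| < 1 / 10 ^+ 5,
            ((log3 beta1)%:E <= hausdorff_dim (R := R) (exceptional_set 3))%E &
            `|log3 beta1 - (228 / 10 ^+ 3 + 392 / 10 ^+ 6)| < 1 / 10 ^+ 6]].
Proof.
move=> phi; have [phi2 lphi uphi] := golden_ratio_bounds phi erefl.
have phi1 : 1 < phi by lra.
split.
- by apply: (gapped_set_dim phi 1) => //; exact: gapped_set_E2.
- have lo : 438%:R / 10 ^+ 3 + 17%:R / 10 ^+ 6 < log3 phi.
    (* 24 binary digits resolve about 6/10^8; the denominator 10^18 keeps the rounding far below
       that. *)
    by apply: (log3_gt _ (10 ^ 18) 24 987 610) => //.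
  (* The right side is 0.438019, written as a complement to fit [log3_lt]. *)
  have hi : log3 phi < 1 - (561%:R / 10 ^+ 3 + 981%:R / 10 ^+ 6).
    apply: (log3_lt _ (10 ^ 18) 24 1597 987) => //; lra.
  by rewrite ltr_norml; apply/andP; split; lra.
have [beta [beta6 lbeta ubeta]] := @beta1_exists R; exists beta; split.
- by rewrite beta6; ring.
- by rewrite ltr_norml; apply/andP; split; lra.
- by apply: (gapped_set_dim beta 5) => //; [lra | exact: gapped_set_E3].
have lo : 228%:R / 10 ^+ 3 + 391%:R / 10 ^+ 6 < log3 beta.
  by apply: (log3_gt _ (10 ^ 18) 24 356 277) => //.
have hi : log3 beta < 1 - (771%:R / 10 ^+ 3 + 607%:R / 10 ^+ 6).
  apply: (log3_lt _ (10 ^ 18) 24 1789 1392) => //; lra.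
by rewrite ltr_norml; apply/andP; split; lra.
Qed.
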